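(* Let $t_a<t_b$ be real numbers and let $t_i=t_a+(t_b-t_a)\sum_{k=1}^{i}\frac{1}{2^k}$ for all $i\in\mathbb{N}$. Consider Hilbert's machine, at rest at $t_a$ with each bead $b_i$ on the right section $s_i$ and every left section $s'_i$ empty, which, if Hilbert's restriction allows it, performs exactly one multidisplacement $m_i$ at each instant $t_i$, and only at these instants, these being the only actions performed. Then at $t_b$ the $\omega$-ordered sequence of multidisplacements $\langle m_i\rangle_{i\in\mathbb{N}}$ has been completed.
   Context: Here $\mathbb{N}=\{1,2,3,\dots\}$. An $\omega$-ordered sequence is one indexed by $\mathbb{N}$: it has a first element, each element has an immediate successor, and there is no last element; such sequences are regarded as complete totalities. Hilbert's machine consists of the following. (1) An infinite wire made of two infinite parts. The right side is divided into an $\omega$-ordered sequence of adjacent sections $\langle s_i\rangle_{i\in\mathbb{N}}$ indexed from left to right ($s_1,s_2,s_3,\dots$). The left side is divided into an $\omega$-ordered sequence of adjacent sections $\langle s'_i\rangle_{i\in\mathbb{N}}$ indexed from right to left ($\dots,s'_3,s'_2,s'_1$). The section $s'_1$ is adjacent to $s_1$. (2) An $\omega$-ordered sequence of beads $\langle b_i\rangle_{i\in\mathbb{N}}$ on the wire, with $b_i$ initially on $s_i$. (3) A mechanism whose only action is the multidisplacement: it simultaneously moves every bead exactly one section to the left, so that a bead on $s_k$ with $k>1$ goes to $s_{k-1}$, a bead on $s_1$ goes to $s'_1$, and a bead on $s'_k$ goes to $s'_{k+1}$. Multidisplacements are assumed instantaneous, and no physical restriction limits the machine. A bead is removed from the wire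 if and only if it is placed out of the wire as a consequence of a multidisplacement. Hilbert's restriction: the machine performs a multidisplacement if and only if that multidisplacement neither removes any bead from the wire nor alters the original $\omega$-order of the beads $b_1,b_2,b_3,\dots$ along the wire (from left to right, $b_{i+1}$ being the immediate successor of $b_i$). The sequence $\langle m_i\rangle_{i\in\mathbb{N}}$ ''has been completed at $t_b$'' means that at $t_b$ all the multidisplacements $m_i$, $i\in\mathbb{N}$, have been carried out. *)

(* Defs.v *)
From Stdlib Require Import Reals PArith.

Open Scope R_scope.

(** Indices range over [positive], that is {1, 2, 3, ...}. *)

(** [Right i] is the section s_i, [Left i] is the section s'_i, and [Out] is
    any place out of the wire; the latter is needed only so that the removal of
    a bead can be expressed. *)
Inductive place : Set :=
| Right (i : positive)
| Left (i : positive)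
| Out.

(** The order of the wire from left to right:
    ..., s'_3, s'_2, s'_1, s_1, s_2, s_3, ... *)
Definition left_of (p q : place) : Prop :=
  match p, q with
  | Left i, Left j => (j < i)%positive
  | Left _, Right _ => True
  | Right i, Right j => (i < j)%positive
  | _, _ => False
  end.

Definition configuration : Type := positive -> place.

Definition move_left (p : place) : place :=
  match p with
  | Right k => if Pos.eqb k 1 then Left 1 else Right (Pos.pred k)
  | Left k => Left (Pos.succ k)
  | Out => Out
  end.

Definition multidisplacement (c : configuration) : configuration :=
  fun b => move_left (c b).

Definition removes_bead (c : configuration) : Prop :=
  exists b, c b <> Out /\ multidisplacement c b = Out.

Definition precedes (c : configuration) (i j : positive) : Prop :=
  left_of (c i) (c j).

Definition immediate_successor (c : configuration) (i j : positive) : Prop :=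
  precedes c i j /\ ~ (exists k, precedes c i k /\ precedes c k j).

Definition in_original_order (c : configuration) : Prop :=
  (forall i j, precedes c i j <-> (i < j)%positive) /\
  (forall i, immediate_successor c i (Pos.succ i)).

(** Hilbert's restriction, for a multidisplacement applied to [c]. *)
Definition allowed (c : configuration) : Prop :=
  ~ removes_bead c /\ in_original_order (multidisplacement c).

Definition instant (ta tb : R) (i : positive) : R :=
  ta + (tb - ta) * sum_f 1 (Pos.to_nat i) (fun k => 1 / 2 ^ k).

(** [state h t] is the configuration at [t], the effect of an action carried out
    at [t] included; [performs h i t] says that m_i is carried out at [t]. *)
Record history : Type := History {
  state : R -> configuration;
  performs : positive -> R -> Prop
}.

(** [c] is the configuration throughout some interval [u, t) with u < t. Such a
    [c] need not exist at an accumulation point of actions. *)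
Definition just_before (h : history) (t : R) (c : configuration) : Prop :=
  exists u, u < t /\ forall v, u <= v < t -> forall b, state h v b = c b.

Record hilbert_run (ta tb : R) (h : history) : Prop := {
  run_initial : forall b, state h ta b = Right b;
  run_only_instants : forall i t, performs h i t -> t = instant ta tb i;
  run_restriction : forall i c,
    just_before h (instant ta tb i) c ->
    (performs h i (instant ta tb i) <-> allowed c);
  run_effect : forall i t c,
    just_before h t c -> performs h i t ->
    forall b, state h t b = multidisplacement c b;
  run_only_actions : forall u v,
    ta <= u <= v ->
    (forall i w, u < w <= v -> ~ performs h i w) ->
    forall b, state h v b = state h u b
}.

Definition completed_at (h : history) (t : R) : Prop :=
  forall i, exists u, u <= t /\ performs h i u.

(* Main.v *)
Require Import Defs.
From Stdlib Require Import Reals PArith.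
From Stdlib Require Import ZArith Lra Lia.

Open Scope R_scope.

(** Number the sections of the wire by the integers, from left to right. A
    multidisplacement then subtracts 1 from the coordinate of every bead, so
    after [n] of them bead [b] has coordinate [b - n]: no bead has left the wire
    ([move_left_on_wire]) and, a translation being an order isomorphism of the
    integers, the original order is intact ([displaced_in_original_order]).
    Hence Hilbert's restriction allows a further multidisplacement, whatever [n]
    is ([displaced_allowed]).

    It remains to follow the run through time. The instants t_1 < t_2 < ... are
    the partial sums of a geometric series, so they increase, start after t_a
    and stay below t_b. Between consecutive instants no action takes place, the
    configuration reached at t_n thus persists until just before t_(n+1), and
    there the restriction decides on it. By induction on [n], m_(n+1) is carried
    out and leaves every bead displaced by [n + 1] ([state_at_stage]). The
    argument never leaves the finite stages: completion at t_b says of each m_i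
    separately that it was carried out before t_b, so no configuration at t_b
    has to be known. *)

(** Coordinates have no gap between the two halves of the wire: s_1 is at 1 and
    s'_1 at 0. The value at [Out] is arbitrary. *)
Definition coordinate (p : place) : Z :=
  match p with
  | Right k => Z.pos k
  | Left k => 1 - Z.pos k
  | Out => 0
  end.

Lemma left_of_coordinate (p q : place) :
  p <> Out -> q <> Out ->
  left_of p q <-> (coordinate p < coordinate q)%Z.
Proof. destruct p, q; cbn [left_of coordinate]; intuition (try congruence; lia). Qed.

Lemma move_left_on_wire (p : place) : p <> Out -> move_left p <> Out.
Proof.
  destruct p as [k | k |]; cbn [move_left]; try congruence.
  destruct (Pos.eqb k 1); congruence.
Qed.

Lemma coordinate_move_left (p : place) :
  p <> Out -> coordinate (move_left p) = (coordinate p - 1)%Z.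
Proof.
  destruct p as [k | k |]; cbn [move_left coordinate]; intros Hp;
    try congruence; try lia.
  destruct (Pos.eqb_spec k 1) as [-> | Hk]; cbn [coordinate]; lia.
Qed.

Definition displaced (n : nat) (c : configuration) : Prop :=
  forall b, c b <> Out /\ coordinate (c b) = (Z.pos b - Z.of_nat n)%Z.

Lemma displaced_multidisplacement (n : nat) (c : configuration) :
  displaced n c -> displaced (S n) (multidisplacement c).
Proof.
  intros Hc b. destruct (Hc b) as [Hw Hz]. unfold multidisplacement. split.
  - now apply move_left_on_wire.
  - rewrite coordinate_move_left by exact Hw. lia.
Qed.

(** In coordinates the beads form a translate of 1, 2, 3, ..., and no integer
    lies strictly between two consecutive ones. *)
Lemma displaced_in_original_order (n : nat) (c : configuration) :
  displaced n c -> in_original_order c.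
Proof.
  intros Hc.
  assert (Hord : forall i j, precedes c i j <-> (i < j)%positive).
  { intros i j. destruct (Hc i) as [Hi Zi], (Hc j) as [Hj Zj].
    unfold precedes. rewrite left_of_coordinate by assumption. lia. }
  split; [exact Hord |].
  intros i. split; [apply Hord; lia |].
  intros [k [H1 H2]]. apply Hord in H1. apply Hord in H2. lia.
Qed.

Lemma displaced_allowed (n : nat) (c : configuration) :
  displaced n c -> allowed c.
Proof.
  intros Hc. split.
  - intros [b [Hw Hout]]. exact (move_left_on_wire _ Hw Hout).
  - apply (displaced_in_original_order (S n)).
    now apply displaced_multidisplacement.
Qed.

(** The closed form of the instants. Indexing by [nat] adds t_a as the stage 0,
    so that the initial configuration is the base case of the induction. *)
Definition stage (ta tb : R) (n : nat) : R := ta + (tb - ta) * (1 - / 2 ^ n).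

Lemma sum_halves (n : nat) :
  sum_f_R0 (fun k => 1 / 2 ^ (k + 1)) n = 1 - / 2 ^ S n.
Proof.
  induction n as [| n IH]; [simpl; lra |].
  rewrite tech5, IH, Nat.add_1_r. simpl.
  field. apply pow_nonzero. lra.
Qed.

Lemma instant_stage (ta tb : R) (i : positive) :
  instant ta tb i = stage ta tb (Pos.to_nat i).
Proof.
  unfold instant, stage, sum_f. rewrite sum_halves.
  replace (S (Pos.to_nat i - 1)) with (Pos.to_nat i) by lia.
  reflexivity.
Qed.

Lemma stage_0 (ta tb : R) : stage ta tb 0 = ta.
Proof. unfold stage. simpl. lra. Qed.

Lemma stage_lt (ta tb : R) (m n : nat) :
  ta < tb -> (m < n)%nat -> stage ta tb m < stage ta tb n.
Proof.
  intros hab Hmn. unfold stage.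
  apply Rplus_lt_compat_l, Rmult_lt_compat_l; [lra |].
  assert (H : / 2 ^ n < / 2 ^ m); [| lra].
  apply Rinv_lt_contravar.
  - apply Rmult_lt_0_compat; apply pow_lt; lra.
  - apply Rlt_pow; [lra | exact Hmn].
Qed.

Lemma stage_le (ta tb : R) (m n : nat) :
  ta < tb -> (m <= n)%nat -> stage ta tb m <= stage ta tb n.
Proof.
  intros hab Hmn. apply Nat.lt_eq_cases in Hmn as [H | ->]; [| lra].
  now apply Rlt_le, stage_lt.
Qed.

Lemma stage_lt_end (ta tb : R) (n : nat) : ta < tb -> stage ta tb n < tb.
Proof.
  intros hab. unfold stage.
  assert (H : 0 < / 2 ^ n) by (apply Rinv_0_lt_compat, pow_lt; lra).
  nra.
Qed.

Section Run.

Variables (ta tb : R) (hab : ta < tb) (h : history).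
Hypothesis hrun : hilbert_run ta tb h.

(** No instant lies strictly between two consecutive stages, so nothing acts on
    the beads there. *)
Lemma just_before_next_stage (n : nat) :
  just_before h (stage ta tb (S n)) (state h (stage ta tb n)).
Proof.
  exists (stage ta tb n). split; [apply stage_lt; [exact hab | lia] |].
  intros v [Hnv Hv].
  apply (run_only_actions _ _ _ hrun).
  - split; [| exact Hnv].
    rewrite <- (stage_0 ta tb) at 1. apply stage_le; [exact hab | lia].
  - intros i w [Hnw Hwv] Hp.
    apply (run_only_instants _ _ _ hrun) in Hp.
    rewrite instant_stage in Hp. subst w.
    destruct (Nat.le_gt_cases (Pos.to_nat i) n) as [Hi | Hi].
    + apply (stage_le ta tb _ _ hab) in Hi. lra.
    + assert (Hi' : (S n <= Pos.to_nat i)%nat) by lia.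
      apply (stage_le ta tb _ _ hab) in Hi'. lra.
Qed.

Lemma performs_next (n : nat) :
  displaced n (state h (stage ta tb n)) ->
  performs h (Pos.of_succ_nat n) (stage ta tb (S n)).
Proof.
  intros Hc.
  assert (Ht : instant ta tb (Pos.of_succ_nat n) = stage ta tb (S n)).
  { rewrite instant_stage, SuccNat2Pos.id_succ. reflexivity. }
  rewrite <- Ht.
  apply (run_restriction _ _ _ hrun _ (state h (stage ta tb n))).
  - rewrite Ht. apply just_before_next_stage.
  - exact (displaced_allowed n _ Hc).
Qed.

Lemma state_at_stage (n : nat) : displaced n (state h (stage ta tb n)).
Proof.
  induction n as [| n IH]; intros b.
  - rewrite stage_0, (run_initial _ _ _ hrun). simpl. split; [congruence | lia].
  - rewrite (run_effect _ _ _ hrun _ _ _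
               (just_before_next_stage n) (performs_next n IH)).
    now apply displaced_multidisplacement.
Qed.

End Run.

Theorem proposition2 (ta tb : R) (hab : ta < tb) (h : history)
  (hrun : hilbert_run ta tb h) : completed_at h tb.
Proof.
  intros i. exists (stage ta tb (Pos.to_nat i)). split.
  - now apply Rlt_le, stage_lt_end.
  - destruct (Pos2Nat.is_succ i) as [n Hn]. rewrite Hn.
    replace i with (Pos.of_succ_nat n)
      by (apply Pos2Nat.inj; rewrite SuccNat2Pos.id_succ; congruence).
    apply performs_next; [exact hab | exact hrun |].
    apply state_at_stage; [exact hab | exact hrun].
Qed.
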